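(* Consider $\min_{x\in\mathbb{R}^{d_x}}F(x)=\varphi(x)+\psi(x)$ with $\varphi,\psi$ and $F$ convex, and let $x_*$ be its solution. Let $\varepsilon>0$, $\sigma\in(0,1)$, $H\ge2L_\varphi$, a starting point $z_0$ and $R_0>0$ with $\|z_0-x_*\|\le R_0$ be given. Assume the following. 1. (Inexact oracle.) A $(\delta,\sigma_0,L,\mu)$-oracle of $F$, a $(\delta,\sigma_0,L_\varphi)$-oracle of $\varphi$ and a $(\delta,\sigma_0,L_\psi)$-oracle of $\psi$ are available, where $\delta=(\delta_1,\delta_2)$, $$\delta_1(\varepsilon),\delta_2(\varepsilon)\le\min\left\{\frac{\varepsilon\mu}{864^2L_\varphi},\frac{\varepsilon\mu}{864^2L_\psi},\frac{\varepsilon\mu^2}{864^2(L+H)^2},\frac{\varepsilon^{3/2}}{5\sqrt{8HR_0^2}}\right\},\qquad \sigma_0(\varepsilon,\sigma)\le\frac{\sigma}{2\left(16\sqrt2\sqrt{H/\mu}+2\right)\log_2\frac{\mu R_0^2}{\varepsilon}} .$$ 2. (Inexact solution of the auxiliary problem.) Algorithm R-AM (see context) is applied, and in each iteration of Algorithm AM used inside R-AM an $(\tilde\varepsilon_f,\tilde\sigma)$-solution to the auxiliary subproblem is available, i.e. with probability at least $1-\tilde\sigma$ $$\left(\langle\nabla\varphi_{\delta,L_\varphi}(x_k^{md}),x_{k+1}^t-x_k^{md}\rangle+\psi(x_{k+1}^t)+\frac H2\|x_{k+1}^t-x_k^{md}\|^2\right)-\min_{z\in\mathbb{R}^{d_x}}\left(\langle\nabla\varphi_{\delta,L_\varphi}(x_k^{md}),z-x_k^{md}\rangle+\psi(z)+\frac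 H2\|z-x_k^{md}\|^2\right)\le\tilde\varepsilon_f,$$ where $$\tilde\varepsilon_f(\varepsilon)\le\frac{\varepsilon\mu^2}{864^2(L+H)^2},\qquad\tilde\sigma(\varepsilon,\sigma)\le\frac{\sigma}{2\left(16\sqrt2\sqrt{H/\mu}+2\right)\log_2\frac{\mu R_0^2}{\varepsilon}} .$$ Then R-AM with $K=2\log_2\frac{\mu R_0^2}{4\varepsilon}$ (rounded up to an integer) outputs a point $z_K$ that is an $(\varepsilon,\sigma)$-solution, i.e. $\mathbb{P}\{F(z_K)-F(x_* )\le\varepsilon\}\ge1-\sigma$. Moreover, the number $N_F$ of calls to the inexact oracles both for $\varphi$ and for $\psi$ satisfies $$N_F\le\left(16\sqrt2\sqrt{\frac H\mu}+2\right)\log_2\frac{\mu R_0^2}{\varepsilon}=\widetilde O\left(\max\left\{\sqrt{\frac H\mu},1\right\}\right),$$ and the number of times the auxiliary subproblem is solved is also equal to $N_F$.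
   Context: $\|\cdot\|$ is the Euclidean norm. $\widetilde O(X)$ hides constant factors and factors polylogarithmic in $\varepsilon^{-1}$ and $\sigma^{-1}$. Probabilistic inexact oracle. Let $\delta=(\delta_1,\delta_2)$ with $\delta_1,\delta_2>0$. A (random) pair $(\varphi_{\delta,L,\mu}(x),\nabla\varphi_{\delta,L,\mu}(x))\in\mathbb{R}\times\mathbb{R}^{d_x}$ is a $(\delta,\sigma_0,L,\mu)$-oracle of a convex function $\varphi$ at $x$ if, with probability $1-\sigma_0$, $\frac\mu2\|z-x\|^2-\delta_1\le\varphi(z)-(\varphi_{\delta,L,\mu}(x)+\langle\nabla\varphi_{\delta,L,\mu}(x),z-x\rangle)\le\frac L2\|z-x\|^2+\delta_2$ for all $z\in\mathbb{R}^{d_x}$. For $\mu=0$ it is called a $(\delta,\sigma_0,L)$-oracle, with notation $(\varphi_{\delta,L}(x),\nabla\varphi_{\delta,L}(x))$. If a single number $\delta$ is given, then $(\delta_1,\delta_2)=(0,\delta)$. Algorithm AM. Input: $\varphi,\psi$ with their inexact oracles, $H>0$, starting point $x_0$. Set $A_0=0$, $x_0^t=x_0^{md}=x_0$. For $k=0,1,2,\dots$: (1) $a_{k+1}=\frac{1+\sqrt{1+8HA_k}}{4H}$, $A_{k+1}=A_k+a_{k+1}$; (2) $x_k^{md}=\frac{A_k}{A_{k+1}}x_k^t+\frac{a_{k+1}}{A_{k+1}}x_k$; (3) find $x_{k+1}^t$ as an approximate solution of the auxiliary subproblem $\min_{z}\{\varphi_{\delta,L_\varphi}(x_k^{md})+\langle\nabla\varphi_{\delta,L_\varphi}(x_k^{md}),z-x_k^{md}\rangle+\psi(z)+\frac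 H2\|z-x_k^{md}\|^2\}$; (4) $x_{k+1}=x_k-a_{k+1}\nabla\varphi_{\delta,L_\varphi}(x_{k+1}^t)-a_{k+1}\nabla\psi_{\delta,L_\psi}(x_{k+1}^t)$. Stopped after $N$ iterations, it outputs $x_N^t$. Algorithm R-AM (restarted AM). Input: as for AM, with starting point $z_0$ and $F=\varphi+\psi$. For $k=0,1,2,\dots$: set $N_k=\max\{\lceil(128H/\mu)^{1/2}\rceil,1\}$ ($\mu$ from the oracle of $F$) and let $z_{k+1}=x_{N_k}^t$ be the output of AM started from $z_k$ and run for $N_k$ iterations. After $K$ restarts, output $z_K$.
   Formalization: It is assumed that 4ε < μR_0² (so K>0); σ_0 bounds the probability that any of the three φ/ψ oracle answers of one AM iteration fails, and N_F counts one joint φ/ψ request per iteration; with separate evaluations the claims fail. *)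

(* Defs.v *)
(* MathComp-Analysis world: everything is over an arbitrary [R : realType], and
   R^d is ['rV[R]_d]. *)
From mathcomp Require Import all_boot all_order all_algebra.
From mathcomp Require Import all_classical all_reals all_analysis.

Set Implicit Arguments.
Unset Strict Implicit.
Unset Printing Implicit Defensive.

Import Order.TTheory GRing.Theory Num.Theory.

Local Open Scope classical_set_scope.
Local Open Scope ring_scope.

Definition dotv (R : realType) (d : nat) (u v : 'rV[R]_d) : R :=
  \sum_(i < d) u 0 i * v 0 i.

(* The library norm [`|x|] on ['rV[R]_d] is the sup norm. *)
Definition enorm (R : realType) (d : nat) (u : 'rV[R]_d) : R :=
  Num.sqrt (dotv u u).

Definition log2 (R : realType) (x : R) : R := ln x / ln 2.

(* The ceiling as a natural number; negative arguments give 0. *)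
Definition nceil (R : realType) (x : R) : nat :=
  absz (Num.max 0 (Num.ceil x))%R.

Definition is_minimizer (R : realType) (V : Type) (f : V -> R) (x : V) : Prop :=
  forall y, f x <= f y.

(* "E holds with probability at least p", for an event E that is not known to
   be measurable: E contains a measurable event of probability at least p.  The
   lemma below is the measurable case. *)
Definition prob_ge (R : realType) (dp : measure_display)
    (T : measurableType dp) (P : probability T R) (p : R) (E : set T) : Prop :=
  exists A : set T, [/\ measurable A, A `<=` E & (p%:E <= P A)%E].

Lemma prob_geE (R : realType) (dp : measure_display)
    (T : measurableType dp) (P : probability T R) (p : R) (E : set T) :
  measurable E -> prob_ge P p E <-> (p%:E <= P E)%E.
Proof.
move=> mE; split => [[A [mA AE pA]]|pE]; last by exists E; split.
exact: le_trans pA (le_measure _ (mem_set mA) (mem_set mE) AE).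
Qed.

(* The inequality required of the answer [o] = (value, gradient) of an inexact
   oracle of [f] at [x]. *)
Definition oracle_ineq (R : realType) (d : nat) (f : 'rV[R]_d -> R)
    (delta1 delta2 L mu : R) (x : 'rV[R]_d) (o : R * 'rV[R]_d) : Prop :=
  forall z : 'rV[R]_d,
    mu / 2 * enorm (z - x) ^+ 2 - delta1 <= f z - (o.1 + dotv o.2 (z - x))
      <= L / 2 * enorm (z - x) ^+ 2 + delta2.

Definition is_oracle (R : realType) (dp : measure_display)
    (T : measurableType dp) (P : probability T R) (d : nat)
    (f : 'rV[R]_d -> R) (delta1 delta2 sigma0 L mu : R)
    (x : 'rV[R]_d) (o : T -> R * 'rV[R]_d) : Prop :=
  prob_ge P (1 - sigma0) [set w | oracle_ineq f delta1 delta2 L mu x (o w)].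

(* What Algorithm AM interacts with.  The first argument of each field numbers
   the requests made so far, so that repeated requests at the same point may
   receive different answers; the randomness is added by taking a function from
   the sample space to [am_env].  [env_sub n x o] is the approximate solution of
   the n-th auxiliary subproblem, whose data are x_k^md and the oracle answer of
   phi at x_k^md. *)
Record am_env (R : realType) (d : nat) := AmEnv {
  env_phi : nat -> 'rV[R]_d -> R * 'rV[R]_d ;
  env_psi : nat -> 'rV[R]_d -> R * 'rV[R]_d ;
  env_sub : nat -> 'rV[R]_d -> R * 'rV[R]_d -> 'rV[R]_d }.

(* [am_calls] counts the calls to the inexact oracles of phi and psi, where one
   call is the request that an iteration makes to both oracles: phi at x_k^md,
   then phi and psi at x_(k+1)^t.  [am_solves] counts the auxiliary subproblems.
   Both counters run on across restarts. *)
Record am_state (R : realType) (d : nat) := AmState {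
  am_A : R ;
  am_x : 'rV[R]_d ;
  am_xt : 'rV[R]_d ;
  am_calls : nat ;
  am_solves : nat }.

Definition am_a (R : realType) (d : nat) (H : R) (s : am_state R d) : R :=
  (1 + Num.sqrt (1 + 8 * H * am_A s)) / (4 * H).

Definition am_Anext (R : realType) (d : nat) (H : R) (s : am_state R d) : R :=
  am_A s + am_a H s.

Definition am_xmd (R : realType) (d : nat) (H : R) (s : am_state R d)
    : 'rV[R]_d :=
  (am_A s / am_Anext H s) *: am_xt s + (am_a H s / am_Anext H s) *: am_x s.

(* Request number [2 * am_calls s] to the oracle of phi; the request at
   x_(k+1)^t of the same iteration has number [2 * am_calls s + 1]. *)
Definition am_phi_md (R : realType) (d : nat) (H : R) (e : am_env R d)
    (s : am_state R d) : R * 'rV[R]_d :=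
  env_phi e (am_calls s).*2 (am_xmd H s).

Definition am_xtnext (R : realType) (d : nat) (H : R) (e : am_env R d)
    (s : am_state R d) : 'rV[R]_d :=
  env_sub e (am_solves s) (am_xmd H s) (am_phi_md H e s).

Definition am_phi_t (R : realType) (d : nat) (H : R) (e : am_env R d)
    (s : am_state R d) : R * 'rV[R]_d :=
  env_phi e (am_calls s).*2.+1 (am_xtnext H e s).

Definition am_psi_t (R : realType) (d : nat) (H : R) (e : am_env R d)
    (s : am_state R d) : R * 'rV[R]_d :=
  env_psi e (am_calls s) (am_xtnext H e s).

Definition am_step (R : realType) (d : nat) (H : R) (e : am_env R d)
    (s : am_state R d) : am_state R d :=
  AmState (am_Anext H s)
          (am_x s - am_a H s *: (am_phi_t H e s).2
                  - am_a H s *: (am_psi_t H e s).2)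
          (am_xtnext H e s)
          (am_calls s).+1
          (am_solves s).+1.

Definition am_start (R : realType) (d : nat) (x0 : 'rV[R]_d)
    (calls solves : nat) : am_state R d :=
  AmState 0 x0 x0 calls solves.

(* The number N_k of AM iterations in each restart. *)
Definition ram_iters (R : realType) (H mu : R) : nat :=
  maxn (nceil (Num.sqrt (128 * H / mu))) 1.

(* The state at the beginning of restart number [k]. *)
Fixpoint ram (R : realType) (d : nat) (H mu : R) (e : am_env R d)
    (z0 : 'rV[R]_d) (k : nat) : am_state R d :=
  if k is k'.+1 then
    let s := iter (ram_iters H mu) (am_step H e) (ram H mu e z0 k') in
    am_start (am_xt s) (am_calls s) (am_solves s)
  else am_start z0 0 0.

(* The state before iteration number [i] of AM inside restart number [k]. *)
Definition ram_at (R : realType) (d : nat) (H mu : R) (e : am_env R d)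
    (z0 : 'rV[R]_d) (k i : nat) : am_state R d :=
  iter i (am_step H e) (ram H mu e z0 k).

Definition ram_point (R : realType) (d : nat) (H mu : R) (e : am_env R d)
    (z0 : 'rV[R]_d) (k : nat) : 'rV[R]_d :=
  am_xt (ram H mu e z0 k).

(* The call made by the iteration that starts in state [s] succeeds.  A call is
   a joint request, so the failure probability sigma_0 of a call is that of the
   conjunction of the three inequalities. *)
Definition am_call_ok (R : realType) (d : nat) (phi psi : 'rV[R]_d -> R)
    (delta1 delta2 Lphi Lpsi H : R) (e : am_env R d) (s : am_state R d)
    : Prop :=
  [/\ oracle_ineq phi delta1 delta2 Lphi 0 (am_xmd H s) (am_phi_md H e s),
      oracle_ineq phi delta1 delta2 Lphi 0 (am_xtnext H e s) (am_phi_t H e s)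
    & oracle_ineq psi delta1 delta2 Lpsi 0 (am_xtnext H e s) (am_psi_t H e s)].

(* Objective of the auxiliary subproblem, without the additive constant
   phi_(delta,L)(x_k^md). *)
Definition am_model (R : realType) (d : nat) (psi : 'rV[R]_d -> R) (H : R)
    (xmd g z : 'rV[R]_d) : R :=
  dotv g (z - xmd) + psi z + H / 2 * enorm (z - xmd) ^+ 2.

Definition am_sub_ok (R : realType) (d : nat) (psi : 'rV[R]_d -> R)
    (H epsf : R) (e : am_env R d) (s : am_state R d) : Prop :=
  let m := am_model psi H (am_xmd H s) (am_phi_md H e s).2 in
  exists zmin : 'rV[R]_d,
    is_minimizer m zmin /\ m (am_xtnext H e s) - m zmin <= epsf.

Definition call_bound (R : realType) (H mu R0 eps : R) : R :=
  (16 * Num.sqrt 2 * Num.sqrt (H / mu) + 2) * log2 (mu * R0 ^+ 2 / eps).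

Definition delta_bound (R : realType) (eps mu L Lphi Lpsi H R0 : R) : R :=
  Num.min
    (Num.min (eps * mu / (864 ^+ 2 * Lphi)) (eps * mu / (864 ^+ 2 * Lpsi)))
    (Num.min (eps * mu ^+ 2 / (864 ^+ 2 * (L + H) ^+ 2))
             (eps `^ (3 / 2) / (5 * Num.sqrt (8 * H * R0 ^+ 2)))).

(* f = softO(g) on the family D of instances: the constant and the exponents
   are the same for all the instances of D. *)
Definition is_softO (R : realType) (I : Type) (D : set I)
    (eps sigma f g : I -> R) : Prop :=
  exists (C : R) (p q : nat), 0 < C /\
    forall i, D i ->
      `|f i| <= C * (1 + `|ln (eps i)^-1|) ^+ p
                  * (1 + `|ln (sigma i)^-1|) ^+ q * `|g i|.

Record params (R : realType) := Params {
  par_H : R ; par_mu : R ; par_R0 : R ; par_eps : R ; par_sigma : R }.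

(* Admissible parameters with a prescribed scale mu R0^2 = rho, which is the
   quantity that the soft-O notation treats as a constant. *)
Definition params_of_scale (R : realType) (rho : R) : set (params R) :=
  [set i | [/\ 0 < par_H i, 0 < par_mu i & 0 < par_R0 i] /\
    [/\ par_mu i * par_R0 i ^+ 2 = rho, 0 < par_eps i, 4 * par_eps i < rho
      & 0 < par_sigma i < 1]].

(* Main.v *)
(* One AM iteration is a large-step (Monteiro-Svaiter) proximal step: with
   g = grad phi(x^t) + grad psi(x^t), s = x^t - x^md and v the residual of the
   auxiliary problem, the error g + H s = (grad phi(x^t) - grad phi(x^md)) + v
   is controlled by cocoercivity, since 2 Lphi <= H.  As 2 H a^2 = A', the
   quantity A (F(x^t) - min F) + |x - xs|^2 / 2 grows by at most A' E per
   iteration, where E is proportional to the inexactness, and A_N >= N^2 / (8 H).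
   The oracle of F at xs yields quadratic growth of F up to O(delta L / mu), so
   that each restart divides |z - xs|^2 by 8 up to O(eps / mu); the constants
   leave enough room that the total noise stays below eps.  A union bound
   over the K N <= call_bound iterations gives the probability. *)
Require Import Defs.
From mathcomp Require Import all_boot all_order all_algebra.
From mathcomp Require Import all_classical all_reals all_analysis.
From mathcomp Require Import ring lra.

Set Implicit Arguments.
Unset Strict Implicit.
Unset Printing Implicit Defensive.

Import Order.TTheory GRing.Theory Num.Theory.

Local Open Scope classical_set_scope.
Local Open Scope ring_scope.

(** * The Euclidean inner product *)

Lemma dotvC (R : realType) (d : nat) (u v : 'rV[R]_d) : dotv u v = dotv v u.
Proof. by apply: eq_bigr => i _; rewrite mulrC. Qed.

Lemma dotvDl (R : realType) (d : nat) (u v w : 'rV[R]_d) :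
  dotv (u + v) w = dotv u w + dotv v w.
Proof. by rewrite -big_split; apply: eq_bigr => i _; rewrite !mxE mulrDl. Qed.

Lemma dotvZl (R : realType) (d : nat) (a : R) (u v : 'rV[R]_d) :
  dotv (a *: u) v = a * dotv u v.
Proof. by rewrite /dotv mulr_sumr; apply: eq_bigr => i _; rewrite !mxE mulrA. Qed.

Lemma dotvNl (R : realType) (d : nat) (u v : 'rV[R]_d) :
  dotv (- u) v = - dotv u v.
Proof. by rewrite -scaleN1r dotvZl mulN1r. Qed.

Lemma dotvDr (R : realType) (d : nat) (u v w : 'rV[R]_d) :
  dotv u (v + w) = dotv u v + dotv u w.
Proof. by rewrite dotvC dotvDl !(dotvC _ u). Qed.

Lemma dotvZr (R : realType) (d : nat) (a : R) (u v : 'rV[R]_d) :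
  dotv u (a *: v) = a * dotv u v.
Proof. by rewrite dotvC dotvZl dotvC. Qed.

Lemma dotvNr (R : realType) (d : nat) (u v : 'rV[R]_d) :
  dotv u (- v) = - dotv u v.
Proof. by rewrite dotvC dotvNl dotvC. Qed.

Lemma dotv0r (R : realType) (d : nat) (u : 'rV[R]_d) : dotv u 0 = 0.
Proof. by rewrite -(scale0r u) dotvZr mul0r. Qed.

Definition dotvE := (dotvDl, dotvDr, dotvNl, dotvNr, dotvZl, dotvZr).

Lemma dotvv_ge0 (R : realType) (d : nat) (u : 'rV[R]_d) : 0 <= dotv u u.
Proof. by apply: sumr_ge0 => i _; rewrite -expr2 sqr_ge0. Qed.

Lemma sqr_enorm (R : realType) (d : nat) (u : 'rV[R]_d) :
  enorm u ^+ 2 = dotv u u.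
Proof. by rewrite sqr_sqrtr // dotvv_ge0. Qed.

(** * Consequences of the oracle inequality *)

(** Test at [w = v / c], where [<v, w> - c |w|^2 / 2] is maximal. This turns comparisons of models
    into bounds on gradients. *)
Lemma dotv_le_quadratic (R : realType) (d : nat) (c e : R) (v : 'rV[R]_d) :
  0 < c -> (forall w, dotv v w <= c / 2 * dotv w w + e) ->
  dotv v v <= 2 * c * e.
Proof.
move=> c0 /(_ (c^-1 *: v)); rewrite !dotvE => h.
have {h} : c * (c^-1 * dotv v v) <= c * (c / 2 * (c^-1 * (c^-1 * dotv v v)) + e).
  by rewrite ler_pM2l.
have -> : c * (c^-1 * dotv v v) = dotv v v by field; rewrite gt_eqF.
have -> : c * (c / 2 * (c^-1 * (c^-1 * dotv v v)) + e) = dotv v v / 2 + c * e.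
  by field; rewrite gt_eqF.
by lra.
Qed.

(** The case [z = x] of the oracle inequality lets [f x] replace the answer [o.1], at the cost of
    adding [delta2] to [delta1]. *)
Lemma oracle_lower (R : realType) (d : nat) (f : 'rV[R]_d -> R)
    (delta1 delta2 L mu : R) (x : 'rV[R]_d) (o : R * 'rV[R]_d) (z : 'rV[R]_d) :
  oracle_ineq f delta1 delta2 L mu x o ->
  f x + dotv o.2 (z - x) + mu / 2 * dotv (z - x) (z - x) - (delta1 + delta2)
    <= f z.
Proof.
move=> h; have /andP[_] := h x; have /andP[+ _] := h z.
by rewrite subrr !sqr_enorm !dotv0r; lra.
Qed.

Lemma oracle_upper (R : realType) (d : nat) (f : 'rV[R]_d -> R)
    (delta1 delta2 L mu : R) (x : 'rV[R]_d) (o : R * 'rV[R]_d) (z : 'rV[R]_d) :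
  oracle_ineq f delta1 delta2 L mu x o ->
  f z <= f x + dotv o.2 (z - x) + L / 2 * dotv (z - x) (z - x)
         + (delta1 + delta2).
Proof.
move=> h; have /andP[+ _] := h x; have /andP[_] := h z.
by rewrite subrr !sqr_enorm !dotv0r; lra.
Qed.

(** The upper model at one point and the lower model at the other are compared at [p + w] for every
    [w]; summing the two orders cancels the function values. *)
Lemma oracle_cocoercive (R : realType) (d : nat) (f : 'rV[R]_d -> R)
    (delta1 delta2 L : R) (x y : 'rV[R]_d) (ox oy : R * 'rV[R]_d) : 0 < L ->
  oracle_ineq f delta1 delta2 L 0 x ox ->
  oracle_ineq f delta1 delta2 L 0 y oy ->
  dotv (oy.2 - ox.2) (oy.2 - ox.2) <=
    L * (dotv (oy.2 - ox.2) (y - x) + 4 * (delta1 + delta2)).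
Proof.
move=> L0 hx hy.
have step (p q : 'rV[R]_d) (op oq : R * 'rV[R]_d) :
    oracle_ineq f delta1 delta2 L 0 p op ->
    oracle_ineq f delta1 delta2 L 0 q oq ->
    dotv (oq.2 - op.2) (oq.2 - op.2) <= 2 * L *
      (f p - f q - dotv oq.2 (p - q) + 2 * (delta1 + delta2)).
  move=> hp hq; apply: dotv_le_quadratic => // w.
  have := oracle_upper (p + w) hp.
  have := oracle_lower (p + w) hq.
  by rewrite (addrC p w) addrK !dotvE; lra.
have := step _ _ _ _ hx hy; have := step _ _ _ _ hy hx.
rewrite -(opprB oy.2) !dotvNl !dotvNr !opprK => h1 h2.
by move: h1 h2; rewrite !dotvE; lra.
Qed.

(** * One accelerated step, in terms of abstract vectors *)

(** Here [D] is the change of the gradient of [phi] along the step [s], [v] the residual of the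
    auxiliary problem and [e] the slack of cocoercivity. *)
Lemma large_step_ineq (R : realType) (d : nat) (H L e : R)
    (D v s : 'rV[R]_d) (g := D + v - H *: s) :
  0 < L -> 2 * L <= H -> dotv D D <= L * (dotv D s + e) ->
  H * dotv g s + dotv g g / 4 <= dotv v v + H * e.
Proof.
move=> L0 LH hD.
(* The sign of [e] is unknown; nonnegativity is read off [hD] and permits replacing [L] by
   [H / 2]. *)
have De0 : 0 <= dotv D s + e.
  by rewrite -(pmulr_rge0 _ L0); apply: le_trans hD; apply: dotvv_ge0.
have {}hD : dotv D D <= H / 2 * (dotv D s + e).
  by apply: le_trans hD _; rewrite ler_wpM2r //; lra.
(* The claim is twice [hD] plus the next four squares, in this order, with weights 3/2, 1/2, 1/4 and
   1/4. *)
have := dotvv_ge0 (D - (H / 2) *: s); have := dotvv_ge0 (v - (H / 2) *: s).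
have := dotvv_ge0 (v - D); have := dotvv_ge0 (H *: s); move: hD.
rewrite /g !dotvE (dotvC v D) (dotvC s D) (dotvC s v).
by lra.
Qed.

(** The lower model at [y] is used at [xt] with weight [A] and at [u] with weight [a]. By the choice
    of [xmd] the linear terms collapse to [A' <g, xmd - y>] and a part cancelled by the expansion of
    the new square; the remaining [a^2 |g|^2 / 2] is paid for by the last hypothesis times
    [2 a^2 = A' / H]. *)
Lemma am_potential_step (R : realType) (d : nat) (F : 'rV[R]_d -> R)
    (u x xt xmd y g : 'rV[R]_d) (a A A' H D E : R) :
  0 <= A -> 0 <= a -> A' = A + a -> A' = 2 * H * a ^+ 2 ->
  A' *: xmd = A *: xt + a *: x ->
  (forall w, F y + dotv g (w - y) - D <= F w) ->
  H * dotv g (y - xmd) + dotv g g / 4 <= H * (E - D) ->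
  A' * (F y - F u) + dotv (x - a *: g - u) (x - a *: g - u) / 2 <=
  A * (F xt - F u) + dotv (x - u) (x - u) / 2 + A' * E.
Proof.
move=> A0 a0 A'D A'H xmdE Fg hE.
have {xmdE} := congr1 (dotv g) xmdE.
have h1 := ler_wpM2l A0 (Fg xt); have h2 := ler_wpM2l a0 (Fg u).
have a2 : 0 <= 2 * a ^+ 2 by rewrite mulr_ge0 ?sqr_ge0.
have := ler_wpM2l a2 hE.
have -> : 2 * a ^+ 2 * (H * dotv g (y - xmd) + dotv g g / 4) =
    A' * dotv g (y - xmd) + a ^+ 2 / 2 * dotv g g by rewrite A'H; field.
have -> : 2 * a ^+ 2 * (H * (E - D)) = A' * (E - D) by rewrite A'H; ring.
move: h1 h2; rewrite !dotvE (dotvC x g) (dotvC u g) (dotvC u x) A'D.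
by lra.
Qed.

(* The upper bound on [psi] near [y] comes from the oracle of F and the
   inexact subgradient of [phi], not from the oracle of [psi]: the bound on [epsf]
   does not involve Lpsi, which may be much larger than L + H. *)
Lemma am_sub_residual (R : realType) (d : nat) (phi psi : 'rV[R]_d -> R)
    (delta1 delta2 L mu H epsf : R) (x y gmd gphi gpsi : 'rV[R]_d)
    (oF : R * 'rV[R]_d) (v := gmd + gpsi + H *: (y - x)) : 0 < L -> 0 < H ->
  oracle_ineq (phi \+ psi) delta1 delta2 L mu y oF ->
  (forall w, phi y + dotv gphi (w - y) - (delta1 + delta2) <= phi w) ->
  (forall w, psi y + dotv gpsi (w - y) - (delta1 + delta2) <= psi w) ->
  (forall w, am_model psi H x gmd y - epsf <= am_model psi H x gmd w) ->
  dotv v v <= 4 * (L + H) * (5 * (delta1 + delta2) + epsf).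
Proof.
move=> L0 H0 hF hphi hpsi hm.
have -> : 4 * (L + H) * (5 * (delta1 + delta2) + epsf) =
    2 * (2 * (L + H)) * (5 * (delta1 + delta2) + epsf) by ring.
apply: dotv_le_quadratic => [|w]; first by lra.
have yw : y - w - y = - w by rewrite addrAC subrr sub0r.
have := oracle_upper (y - w) hF; have := oracle_upper (y + w) hF.
have := hphi (y - w); have := hm (y - w).
have := hphi (y + w); have := hpsi (y + w).
have := mulr_ge0 (ltW H0) (dotvv_ge0 w).
rewrite /am_model !sqr_enorm yw (addrC y w) addrK /v !dotvE.
rewrite (dotvC w y) (dotvC x y) (dotvC w x) /=.
by lra.
Qed.

(** * Step sizes, single iterations and runs of AM *)

Lemma am_a_gt0 (R : realType) (d : nat) (H : R) (s : am_state R d) :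
  0 < H -> 0 < am_a H s.
Proof.
by move=> H0; rewrite divr_gt0 ?mulr_gt0 // ltr_pwDl ?sqrtr_ge0.
Qed.

(** [am_a] is the positive root of [2 H a^2 = A + a]; expressing [A] through the square root makes
    this a field identity. *)
Lemma am_AnextE (R : realType) (d : nat) (H : R) (s : am_state R d) :
  0 < H -> 0 <= am_A s -> am_Anext H s = 2 * H * am_a H s ^+ 2.
Proof.
move=> H0 A0; rewrite /am_Anext /am_a.
have r0 : 0 <= 1 + 8 * H * am_A s by rewrite addr_ge0 // !mulr_ge0 // ltW.
have -> : am_A s = (Num.sqrt (1 + 8 * H * am_A s) ^+ 2 - 1) / (8 * H).
  by rewrite sqr_sqrtr //; field; rewrite gt_eqF.
set q := Num.sqrt (1 + 8 * H * am_A s).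
have -> : Num.sqrt (1 + 8 * H * ((q ^+ 2 - 1) / (8 * H))) = q.
  have -> : 1 + 8 * H * ((q ^+ 2 - 1) / (8 * H)) = q ^+ 2.
    by field; rewrite gt_eqF.
  by rewrite sqrtr_sqr ger0_norm // sqrtr_ge0.
by field; rewrite gt_eqF.
Qed.

(** By induction the root in [am_a] is at least [n], so [8 H A] grows by at least
    [2 (1 + n) >= (n + 1)^2 - n^2]. *)
Lemma am_A_growth (R : realType) (d : nat) (H : R) (e : am_env R d)
    (x0 : 'rV[R]_d) (c c' n : nat) : 0 < H ->
  n%:R ^+ 2 <= 8 * H * am_A (iter n (am_step H e) (am_start x0 c c')).
Proof.
move=> H0; elim: n => [|n IH]; first by rewrite expr0n /= mulr0.
rewrite iterS /= /am_Anext; set s := iter _ _ _ in IH *.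
have : n%:R <= Num.sqrt (1 + 8 * H * am_A s).
  rewrite -[n%:R]ger0_norm ?ler0n // -sqrtr_sqr ler_wsqrtr //.
  by apply: le_trans IH _; rewrite lerDr.
rewrite /am_a; move: (Num.sqrt _) => q nq.
have -> : 8 * H * (am_A s + (1 + q) / (4 * H)) = 8 * H * am_A s + 2 * (1 + q).
  by field; rewrite gt_eqF.
by rewrite -natr1; lra.
Qed.

(** In the budget for [E], the first summand bounds the squared residual of the auxiliary problem;
    [6 H] is [4 H] from cocoercivity plus [2 H] from the lower models of [phi] and [psi] at the new
    point. *)
Lemma am_step_gap (R : realType) (d : nat) (phi psi : 'rV[R]_d -> R)
    (delta1 delta2 L mu Lphi Lpsi H epsf E : R) (oF : R * 'rV[R]_d)
    (e : am_env R d) (s : am_state R d) (u : 'rV[R]_d)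
    (F := phi \+ psi) (s' := am_step H e s) :
  0 < L -> 0 < Lphi -> 2 * Lphi <= H -> 0 <= am_A s ->
  oracle_ineq F delta1 delta2 L mu (am_xt s') oF ->
  am_call_ok phi psi delta1 delta2 Lphi Lpsi H e s ->
  am_sub_ok psi H epsf e s ->
  4 * (L + H) * (5 * (delta1 + delta2) + epsf) + 6 * H * (delta1 + delta2)
    <= H * E ->
  am_A s' * (F (am_xt s') - F u) + dotv (am_x s' - u) (am_x s' - u) / 2 <=
  am_A s * (F (am_xt s) - F u) + dotv (am_x s - u) (am_x s - u) / 2
    + am_A s' * E.
Proof.
move=> L0 Lp0 LH A0 hF [hmd ht hpsi] [zmin [hmin hsub]] hE.
have H0 : 0 < H by lra.
have lower (f : 'rV[R]_d -> R) L' o :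
    oracle_ineq f delta1 delta2 L' 0 (am_xt s') o ->
    forall w, f (am_xt s') + dotv o.2 (w - am_xt s') - (delta1 + delta2) <= f w.
  by move=> ho w; have := oracle_lower w ho; lra.
have hphi' := lower _ _ _ ht; have hpsi' := lower _ _ _ hpsi.
have hv := am_sub_residual (epsf := epsf) L0 H0 hF hphi' hpsi'.
have {hmin hsub} /hv {}hv : forall w,
    am_model psi H (am_xmd H s) (am_phi_md H e s).2 (am_xt s') - epsf <=
    am_model psi H (am_xmd H s) (am_phi_md H e s).2 w.
  by move=> w; have := hmin w; move: hsub => /=; lra.
have hD := oracle_cocoercive Lp0 hmd ht.
set g := (am_phi_t H e s).2 + (am_psi_t H e s).2.
set v := _ + _ + H *: (am_xt s' - am_xmd H s) in hv *.
have := large_step_ineq v Lp0 LH hD.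
have -> : (am_phi_t H e s).2 - (am_phi_md H e s).2 + v
    - H *: (am_xt s' - am_xmd H s) = g.
  by rewrite /v addrA addrK addrA subrK.
move=> hg.
have a0 := am_a_gt0 s H0.
have A'H := am_AnextE H0 A0.
have A'0 : 0 < am_Anext H s by rewrite /am_Anext ltr_wpDl.
have -> : am_x s' = am_x s - am_a H s *: g by rewrite /= scalerDr opprD addrA.
rewrite -[am_A s']/(am_Anext H s).
apply: (am_potential_step (xmd := am_xmd H s) (D := 2 * (delta1 + delta2)) u
  A0 (ltW a0) _ A'H) => //.
- rewrite /am_xmd scalerDr !scalerA mulrCA divff ?gt_eqF // mulr1.
  by rewrite mulrCA divff ?gt_eqF // mulr1.
- by move=> w; have := hphi' w; have := hpsi' w; rewrite /g !dotvE /F /=; lra.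
- by move: hg hv hE; lra.
Qed.

(** A plain proximal gradient estimate whose noise is not divided by [H]. It serves restarts that
    consist of one iteration. *)
Lemma am_step_le (R : realType) (d : nat) (phi psi : 'rV[R]_d -> R)
    (delta1 delta2 Lphi Lpsi H epsf : R) (e : am_env R d) (s : am_state R d)
    (u : 'rV[R]_d) :
  2 * Lphi <= H -> 0 < H ->
  am_call_ok phi psi delta1 delta2 Lphi Lpsi H e s ->
  am_sub_ok psi H epsf e s ->
  (phi \+ psi) (am_xt (am_step H e s)) <=
  (phi \+ psi) u + H / 2 * dotv (am_xmd H s - u) (am_xmd H s - u)
  + epsf + 2 * (delta1 + delta2).
Proof.
move=> LH H0 [hmd _ _] [zmin [/(_ u) hmin hsub]] /=.
have := oracle_lower u hmd; have := oracle_upper (am_xtnext H e s) hmd.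
have sq_ge0 := dotvv_ge0 (am_xtnext H e s - am_xmd H s).
have : Lphi / 2 * dotv (am_xtnext H e s - am_xmd H s) (am_xtnext H e s - am_xmd H s)
   <= H / 2 * dotv (am_xtnext H e s - am_xmd H s) (am_xtnext H e s - am_xmd H s).
  by rewrite ler_wpM2r //; lra.
move: hmin hsub; rewrite /am_model !sqr_enorm -[am_xmd H s - u]opprB.
rewrite dotvNl dotvNr opprK.
by lra.
Qed.

Lemma am_A_ge0 (R : realType) (d : nat) (H : R) (e : am_env R d)
    (x0 : 'rV[R]_d) (c c' n : nat) : 0 < H ->
  0 <= am_A (iter n (am_step H e) (am_start x0 c c')).
Proof.
move=> H0; have := am_A_growth e x0 c c' n H0.
by move=> /(le_trans (sqr_ge0 _)); rewrite pmulr_rge0 // mulr_gt0.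
Qed.

(** Iteration [i] contributes noise [A_(i+1) E]; as [A] increases, the sum is at most [n A_n E] and
    fits inside the bracket. *)
Lemma am_run_gap (R : realType) (d : nat) (phi psi : 'rV[R]_d -> R)
    (delta1 delta2 L mu Lphi Lpsi H epsf E : R)
    (e : am_env R d) (x0 u : 'rV[R]_d) (c c' n : nat)
    (F := phi \+ psi) (s := fun i => iter i (am_step H e) (am_start x0 c c')) :
  0 < L -> 0 < Lphi -> 2 * Lphi <= H -> 0 <= E ->
  (forall x, exists o, oracle_ineq F delta1 delta2 L mu x o) ->
  (forall i, (i < n)%N ->
    am_call_ok phi psi delta1 delta2 Lphi Lpsi H e (s i)) ->
  (forall i, (i < n)%N -> am_sub_ok psi H epsf e (s i)) ->
  4 * (L + H) * (5 * (delta1 + delta2) + epsf) + 6 * H * (delta1 + delta2)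
    <= H * E ->
  am_A (s n) * (F (am_xt (s n)) - F u - n%:R * E)
    + dotv (am_x (s n) - u) (am_x (s n) - u) / 2
  <= dotv (x0 - u) (x0 - u) / 2.
Proof.
move=> L0 Lp0 LH E0 hF hcall hsub hE.
have H0 : 0 < H by lra.
elim: n hcall hsub => [|n IH] hcall hsub; first by rewrite /= mul0r add0r.
have IHn : am_A (s n) * (F (am_xt (s n)) - F u - n%:R * E)
    + dotv (am_x (s n) - u) (am_x (s n) - u) / 2 <= dotv (x0 - u) (x0 - u) / 2.
  by apply: IH => i /ltnW; [apply: hcall | apply: hsub].
have A0 : 0 <= am_A (s n) by apply: am_A_ge0.
have [p ho] := hF (am_xt (s n.+1)).
have := am_step_gap u L0 Lp0 LH A0 ho (hcall n (ltnSn n)) (hsub n (ltnSn n)) hE.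
rewrite -/(s n.+1) -[am_step H e (s n)]/(s n.+1) -/F.
have : am_A (s n) * (n%:R * E) <= am_A (s n.+1) * (n%:R * E).
  rewrite ler_wpM2r ?mulr_ge0 //= lerDl.
  exact: ltW (am_a_gt0 _ H0).
move: IHn; rewrite -natr1.
by lra.
Qed.

(** Divide the previous bound by [A_n >= n^2 / (8 H)]; then [1 / (2 A_n) <= 4 H / n^2 <= kappa]. *)
Lemma am_run_rate (R : realType) (d : nat) (phi psi : 'rV[R]_d -> R)
    (delta1 delta2 L mu Lphi Lpsi H epsf E kappa : R)
    (e : am_env R d) (x0 u : 'rV[R]_d) (c c' n : nat)
    (F := phi \+ psi) (s := fun i => iter i (am_step H e) (am_start x0 c c')) :
  0 < L -> 0 < Lphi -> 2 * Lphi <= H -> 0 <= E ->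
  (forall x, exists o, oracle_ineq F delta1 delta2 L mu x o) ->
  (forall i, (i < n)%N ->
    am_call_ok phi psi delta1 delta2 Lphi Lpsi H e (s i)) ->
  (forall i, (i < n)%N -> am_sub_ok psi H epsf e (s i)) ->
  4 * (L + H) * (5 * (delta1 + delta2) + epsf) + 6 * H * (delta1 + delta2)
    <= H * E ->
  (0 < n)%N -> 4 * H <= kappa * n%:R ^+ 2 ->
  F (am_xt (s n)) - F u <= kappa * dotv (x0 - u) (x0 - u) + n%:R * E.
Proof.
move=> L0 Lp0 LH E0 hF hcall hsub hE n0 hn.
have H0 : 0 < H by lra.
have := am_run_gap u L0 Lp0 LH E0 hF hcall hsub hE.
have := am_A_growth e x0 c c' n H0; rewrite -/(s n).
have := dotvv_ge0 (am_x (s n) - u); have := dotvv_ge0 (x0 - u).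
move: (dotv _ _) (dotv _ _) (am_A _) => r2' r2 A r20 r2'0 hA.
rewrite -lerBlDr -/F; move: (F _ - F u - _) => t ht.
have n20 : 0 < n%:R ^+ 2 :> R by rewrite exprn_gt0 // ltr0n.
have k0 : 0 < kappa.
  by rewrite -(pmulr_lgt0 _ n20); apply: lt_le_trans hn; rewrite mulr_gt0.
(* The lower bound on [A] helps only for positive [t]. *)
have [t0|t0] := leP t 0; first by apply: le_trans t0 _; rewrite mulr_ge0 // ltW.
rewrite -(ler_pM2l n20).
have h1 := ler_wpM2r (ltW t0) hA; have h2 := ler_wpM2r r20 hn.
have h3 : H * (A * t) <= H * (r2 / 2) by rewrite ler_pM2l //; lra.
by lra.
Qed.

(** * What an oracle of F implies: growth at the minimizer and [mu <= L] *)

(** Minimality and the upper model make the oracle gradient at [xs] small,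
    [|o.2|^2 <= 2 L (delta1 + delta2)]; completing a square then costs half of the quadratic term of
    the lower model. *)
Lemma quadratic_growth (R : realType) (d : nat) (F : 'rV[R]_d -> R)
    (delta1 delta2 L mu : R) (xs z : 'rV[R]_d) (o : R * 'rV[R]_d) :
  0 < L -> 0 < mu -> is_minimizer F xs ->
  oracle_ineq F delta1 delta2 L mu xs o ->
  mu ^+ 2 / 4 * dotv (z - xs) (z - xs) - (mu + 2 * L) * (delta1 + delta2)
    <= mu * (F z - F xs).
Proof.
move=> L0 mu0 xs_min ho.
have : dotv (- o.2) (- o.2) <= 2 * L * (delta1 + delta2).
  apply: dotv_le_quadratic => // w.
  have := oracle_upper (xs + w) ho; have := xs_min (xs + w).
  by rewrite (addrC xs) addrK !dotvE; lra.
have := ler_wpM2l (ltW mu0) (oracle_lower z ho).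
have := dotvv_ge0 (o.2 + (mu / 2) *: (z - xs)).
move: (z - xs) => r; rewrite !dotvE (dotvC r).
by lra.
Qed.

(** Otherwise the lower model overtakes the upper one along a long vector; a nonzero vector exists
    because the dimension is positive. *)
Lemma oracle_constants_le (R : realType) (d : nat) (f : 'rV[R]_d.+1 -> R)
    (delta1 delta2 L mu : R) (x : 'rV[R]_d.+1) (o : R * 'rV[R]_d.+1) :
  oracle_ineq f delta1 delta2 L mu x o -> mu <= L.
Proof.
move=> ho; rewrite leNgt; apply/negP => Lmu.
pose D := delta1 + delta2.
have D0 : 0 <= D.
  have := oracle_lower x ho; have := oracle_upper x ho.
  by rewrite /D subrr !dotv0r; lra.
(* The models force [(mu - L) q^2 <= 4 D], while this [q >= 1] gives [(mu - L) q > 4 D]. *)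
pose q := 1 + 4 * D / (mu - L).
pose w := q *: delta_mx 0 0 : 'rV[R]_d.+1.
have wE : dotv w w = q ^+ 2.
  rewrite /dotv big_ord_recl big1 ?addr0 => [|i _]; rewrite !mxE /= ?mulr0 //.
  by rewrite !mulr1.
have muL : 0 < mu - L by rewrite subr_gt0.
have q1 : 1 <= q by rewrite lerDl divr_ge0 ?mulr_ge0 // ltW.
have := oracle_lower (x + w) ho; have := oracle_upper (x + w) ho.
rewrite (addrC x) addrK wE -/D => h1 h2.
have : (mu - L) * q <= (mu - L) * q ^+ 2.
  by rewrite ler_pM2l // expr2 ler_peMl //; lra.
have -> : (mu - L) * q = mu - L + 4 * D by rewrite /q; field; rewrite gt_eqF.
by lra.
Qed.

(** * Counters across restarts *)

Lemma iter_am_calls (R : realType) (d : nat) (H : R) (e : am_env R d)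
    (s : am_state R d) (n : nat) :
  am_calls (iter n (am_step H e) s) = (am_calls s + n)%N.
Proof. by elim: n => [|n IH]; rewrite ?addn0 //= IH addnS. Qed.

Lemma iter_am_solves (R : realType) (d : nat) (H : R) (e : am_env R d)
    (s : am_state R d) (n : nat) :
  am_solves (iter n (am_step H e) s) = (am_solves s + n)%N.
Proof. by elim: n => [|n IH]; rewrite ?addn0 //= IH addnS. Qed.

Lemma ram_calls (R : realType) (d : nat) (H mu : R) (e : am_env R d)
    (z0 : 'rV[R]_d) (k : nat) :
  am_calls (ram H mu e z0 k) = (k * ram_iters H mu)%N.
Proof. by elim: k => // k IH /=; rewrite iter_am_calls IH mulSnr. Qed.

Lemma ram_solves (R : realType) (d : nat) (H mu : R) (e : am_env R d)
    (z0 : 'rV[R]_d) (k : nat) :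
  am_solves (ram H mu e z0 k) = (k * ram_iters H mu)%N.
Proof. by elim: k => // k IH /=; rewrite iter_am_solves IH mulSnr. Qed.

Lemma ramE (R : realType) (d : nat) (H mu : R) (e : am_env R d)
    (z0 : 'rV[R]_d) (k : nat) :
  ram H mu e z0 k = am_start (ram_point H mu e z0 k)
    (am_calls (ram H mu e z0 k)) (am_solves (ram H mu e z0 k)).
Proof. by case: k. Qed.

(** * Rounding and binary logarithms *)

Lemma nceil_ge (R : realType) (x : R) : x <= (nceil x)%:R.
Proof.
rewrite /nceil natr_absz ger0_norm ?le_max ?lexx //.
by apply: le_trans (Num.Theory.ceil_ge x) _; rewrite ler_int le_max lexx orbT.
Qed.

Lemma nceil_lt (R : realType) (x : R) : 0 <= x -> (nceil x)%:R < x + 1.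
Proof.
move=> x0; have c0 : (0 <= Num.ceil x)%R.
  by rewrite Num.Theory.ceil_ge0 (lt_le_trans _ x0).
rewrite /nceil natr_absz ger0_norm ?le_max ?lexx // max_r //.
by have := Num.Theory.ceilB1_lt x; rewrite intrB ltrBlDr.
Qed.

Lemma le_pow_log2 (R : realType) (x : R) (n : nat) :
  0 < x -> log2 x <= n%:R -> x <= 2 ^+ n.
Proof.
move=> x0; have l2 : 0 < ln (2 : R) by rewrite ln_gt0 // ltr1n.
by rewrite ler_pdivrMr // mulr_natl -lnXn // ler_ln // posrE // exprn_gt0.
Qed.

Lemma log2M (R : realType) (x y : R) :
  0 < x -> 0 < y -> log2 (x * y) = log2 x + log2 y.
Proof. by move=> x0 y0; rewrite /log2 lnM // mulrDl. Qed.

Lemma log2_gt0 (R : realType) (x : R) : 1 < x -> 0 < log2 x.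
Proof. by move=> x1; rewrite divr_gt0 // ln_gt0 // ltr1n. Qed.

Lemma log2_4 (R : realType) : log2 (4 : R) = 2.
Proof.
have l2 : 0 < ln (2 : R) by rewrite ln_gt0 // ltr1n.
have -> : 4 = 2 ^+ 2 :> R by lra.
by rewrite /log2 lnXn // -[X in X / _]mulr_natl mulfK // gt_eqF.
Qed.

(** * Events of large probability *)

Lemma prob_geS (R : realType) (dp : measure_display) (T : measurableType dp)
    (P : probability T R) (p q : R) (A B : set T) :
  q <= p -> A `<=` B -> prob_ge P p A -> prob_ge P q B.
Proof.
move=> qp AB [C [mC CA pC]]; exists C; split => //.
  exact: subset_trans CA AB.
by apply: le_trans pC; rewrite lee_fin.
Qed.

Lemma prob_ge_nonempty (R : realType) (dp : measure_display)
    (T : measurableType dp) (P : probability T R) (p : R) (A : set T) :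
  0 < p -> prob_ge P p A -> A !=set0.
Proof.
move=> p0 [C [mC CA pC]]; have [C0|/set0P[w Cw]] := eqVneq C set0.
  by move: pC; rewrite C0 measure0 lee_fin leNgt p0.
by exists w; apply: CA.
Qed.

Lemma prob_geI (R : realType) (dp : measure_display) (T : measurableType dp)
    (P : probability T R) (s t : R) (A B : set T) :
  prob_ge P (1 - s) A -> prob_ge P (1 - t) B -> prob_ge P (1 - (s + t)) (A `&` B).
Proof.
move=> [C [mC CA pC]] [D [mD DB pD]]; exists (C `&` D); split.
- exact: measurableI.
- exact: setISS.
have hU : (P C + P D - P (C `&` D) <= 1)%E.
  rewrite -measureUfinl //; first exact: probability_le1 (measurableU _ _ mC mD).
  by rewrite (le_lt_trans (probability_le1 P mC)) // ltry.
move: pC pD hU; have := measurableI _ _ mC mD.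
move/(fin_num_measure P)/fineK => <-.
have /fineK <- := fin_num_measure P _ mC.
have /fineK <- := fin_num_measure P _ mD.
by rewrite -EFinD !lee_fin; lra.
Qed.

Lemma prob_ge_forall (R : realType) (dp : measure_display)
    (T : measurableType dp) (P : probability T R) (s : R) (E : nat -> set T)
    (n : nat) :
  (forall i, (i < n)%N -> prob_ge P (1 - s) (E i)) ->
  prob_ge P (1 - n%:R * s) [set w | forall i, (i < n)%N -> E i w].
Proof.
elim: n => [|n IH] hE.
  exists setT; split => //.
  by rewrite mul0r subr0 (probability_setT P).
have := prob_geI (IH (fun i hi => hE i (ltnW hi))) (hE n (ltnSn n)).
apply: prob_geS => [|w [hw hn] i].
  by rewrite -natr1 mulrDl mul1r.
by rewrite ltnS leq_eqVlt => /orP[/eqP->|/hw].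
Qed.

(** * Length of a restart and progress over restarts *)

Lemma ram_iters_gt0 (R : realType) (H mu : R) : (0 < ram_iters H mu)%N.
Proof. by rewrite leq_max orbT. Qed.

Lemma ram_iters_eq1 (R : realType) (H mu : R) :
  0 < mu -> 128 * H <= mu -> ram_iters H mu = 1%N.
Proof.
move=> mu0 Hmu; apply/maxn_idPr; rewrite -ltnS -(ltr_nat R).
apply: lt_le_trans (nceil_lt (sqrtr_ge0 _)) _.
have : Num.sqrt (128 * H / mu) <= Num.sqrt 1.
  by rewrite ler_wsqrtr // ler_pdivrMr // mul1r.
by rewrite sqrtr1; lra.
Qed.

Lemma ram_iters_sqr_ge (R : realType) (H mu : R) :
  0 < H -> 0 < mu -> 128 * H <= mu * (ram_iters H mu)%:R ^+ 2.
Proof.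
move=> H0 mu0; rewrite -ler_pdivrMl // mulrC.
have r0 : 0 <= 128 * H / mu by rewrite divr_ge0 ?mulr_ge0 // ltW.
rewrite -[X in X <= _](sqr_sqrtr r0) lerXn2r ?nnegrE ?sqrtr_ge0 ?ler0n //.
by apply: le_trans (nceil_ge _) _; rewrite ler_nat leq_maxl.
Qed.

Lemma ram_iters_le (R : realType) (H mu : R) :
  (ram_iters H mu)%:R <= Num.sqrt (128 * H / mu) + 1.
Proof.
rewrite /ram_iters /maxn; case: ifP => _; first by rewrite lerDr sqrtr_ge0.
exact: ltW (nceil_lt (sqrtr_ge0 _)).
Qed.

(** With [r = sqrt(128 H / mu) >= 1], the length is at most [r + 1 <= 2 r^2]. This controls [n]
    times a noise proportional to [1 / H]. *)
Lemma mu_ram_iters_le (R : realType) (H mu : R) :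
  0 < mu -> mu < 128 * H -> mu * (ram_iters H mu)%:R <= 256 * H.
Proof.
move=> mu0 muH; have := ram_iters_le H mu.
have r0 : 0 <= 128 * H / mu by rewrite divr_ge0 //; lra.
have rE : mu * Num.sqrt (128 * H / mu) ^+ 2 = 128 * H.
  by rewrite sqr_sqrtr // mulrC divfK // gt_eqF.
have r1 : 1 <= Num.sqrt (128 * H / mu).
  rewrite -[X in X <= _]sqrtr1 ler_wsqrtr // ler_pdivlMr // mul1r.
  exact: ltW.
move: (Num.sqrt _) r1 rE => r r1 rE Nr.
have : mu * (ram_iters H mu)%:R <= mu * (2 * r ^+ 2); last by lra.
rewrite ler_pM2l //; apply: le_trans Nr _.
have : r <= r ^+ 2 by rewrite expr2 ler_peMl //; lra.
by lra.
Qed.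

(* The constant 720 * 1000 lies between 56 * 256 * 50, which makes the
   total noise at most eps / 50, and 864 ^ 2.  When 128 H <= mu there is a
   single iteration and it is bounded directly, because the noise term of
   [am_run_rate] is proportional to 1 / H. *)
Lemma am_restart_gap (R : realType) (d : nat) (phi psi : 'rV[R]_d -> R)
    (delta1 delta2 L mu Lphi Lpsi H epsf eps D : R)
    (e : am_env R d) (x0 u : 'rV[R]_d) (c c' : nat) (n := ram_iters H mu)
    (F := phi \+ psi) (s := fun i => iter i (am_step H e) (am_start x0 c c')) :
  0 < L -> 0 < Lphi -> 2 * Lphi <= H -> 0 < mu -> mu <= L -> 0 < eps ->
  0 < D -> delta1 <= D -> delta2 <= D -> epsf <= D ->
  720 * 1000 * ((L + H) * D) <= eps * mu ->
  (forall x, exists o, oracle_ineq F delta1 delta2 L mu x o) ->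
  (forall i, (i < n)%N ->
    am_call_ok phi psi delta1 delta2 Lphi Lpsi H e (s i)) ->
  (forall i, (i < n)%N -> am_sub_ok psi H epsf e (s i)) ->
  F (am_xt (s n)) - F u <= mu / 32 * dotv (x0 - u) (x0 - u) + eps / 50.
Proof.
move=> L0 Lp0 LH mu0 muL eps0 D0 d1D d2D efD DE hF hcall hsub.
have H0 : 0 < H by lra.
have [Hmu|muH] := leP (128 * H) mu.
  have n1 : n = 1%N by apply: ram_iters_eq1.
  have {}hcall := hcall 0%N (ram_iters_gt0 H mu).
  have {}hsub := hsub 0%N (ram_iters_gt0 H mu).
  rewrite n1; have := am_step_le u LH H0 hcall hsub.
  rewrite -[am_step _ _ _]/(s 1%N) -/F.
  (* A run starts with [A = 0], so its first extrapolated point is the starting point. *)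
  have -> : am_xmd H (s 0%N) = x0.
    rewrite /am_xmd /am_Anext /= mul0r scale0r !add0r divff ?scale1r //.
    by rewrite gt_eqF // am_a_gt0.
  have : H / 2 * dotv (x0 - u) (x0 - u) <= mu / 32 * dotv (x0 - u) (x0 - u).
    by rewrite ler_wpM2r ?dotvv_ge0 //; lra.
  have : mu * D <= (L + H) * D by rewrite ler_pM2r; lra.
  have : mu * (720 * 1000 * D) <= mu * eps -> 720 * 1000 * D <= eps.
    by rewrite ler_pM2l.
  by lra.
(* 56 is [4 * 11 + 6 * 2], from bounding [delta1], [delta2] and [epsf] by [D]. *)
pose E := 56 * (eps * mu) / (720 * 1000) / H.
have HE : H * E = 56 * (eps * mu) / (720 * 1000).
  by rewrite mulrC divfK // gt_eqF.
have E0 : 0 <= E.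
  by rewrite -(pmulr_rge0 _ H0) HE; have := mulr_gt0 eps0 mu0; lra.
have hE : 4 * (L + H) * (5 * (delta1 + delta2) + epsf)
    + 6 * H * (delta1 + delta2) <= H * E.
  have h1 : (L + H) * (5 * (delta1 + delta2) + epsf) <= (L + H) * (11 * D).
    by rewrite ler_pM2l; lra.
  have h2 : H * (delta1 + delta2) <= H * (2 * D) by rewrite ler_pM2l; lra.
  have h3 : 0 <= L * D by rewrite mulr_ge0 // ltW.
  by rewrite HE; lra.
have n0 : (0 < n)%N := ram_iters_gt0 H mu.
(* The 128 in the restart length yields [mu / 32]; against the [mu / 4] of quadratic growth this is
   the contraction factor 8. *)
have hn : 4 * H <= mu / 32 * n%:R ^+ 2.
  by have := ram_iters_sqr_ge H0 mu0; rewrite -/n; lra.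
have := am_run_rate u L0 Lp0 LH E0 hF hcall hsub hE n0 hn.
rewrite -/(s n) -/F.
have : n%:R * E <= eps / 50; last by lra.
rewrite -(ler_pM2l H0) mulrCA HE.
have : eps * (mu * n%:R) <= eps * (256 * H).
  by rewrite ler_pM2l // mu_ram_iters_le.
by have := mulr_gt0 eps0 H0; lra.
Qed.

Lemma ram_gap (R : realType) (d : nat) (phi psi : 'rV[R]_d -> R)
    (delta1 delta2 L mu Lphi Lpsi H epsf eps D R0 : R)
    (e : am_env R d) (z0 xs : 'rV[R]_d) (K : nat) (F := phi \+ psi) :
  0 < L -> 0 < Lphi -> 2 * Lphi <= H -> 0 < mu -> 0 < eps ->
  0 < D -> delta1 <= D -> delta2 <= D -> epsf <= D ->
  (mu <= L -> 720 * 1000 * ((L + H) * D) <= eps * mu) ->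
  is_minimizer F xs -> enorm (z0 - xs) <= R0 -> (0 < K)%N ->
  mu * R0 ^+ 2 <= 4 * eps * 2 ^+ K ->
  (forall x, exists o, oracle_ineq F delta1 delta2 L mu x o) ->
  (forall k i, (k < K)%N -> (i < ram_iters H mu)%N ->
    am_call_ok phi psi delta1 delta2 Lphi Lpsi H e (ram_at H mu e z0 k i)) ->
  (forall k i, (k < K)%N -> (i < ram_iters H mu)%N ->
    am_sub_ok psi H epsf e (ram_at H mu e z0 k i)) ->
  F (ram_point H mu e z0 K) - F xs <= eps.
Proof.
move=> L0 Lp0 LH mu0 eps0 D0 d1D d2D efD + xs_min z0R K0 hK hF hcall hsub.
(* In dimension 0 there is a single point; in positive dimension [mu <= L] becomes available and
   unlocks the bound on [D]. *)
case: d phi psi e z0 xs @F xs_min z0R hF hcall hsub => [|d]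
  phi psi e z0 xs F xs_min z0R hF hcall hsub DE.
  by rewrite [ram_point _ _ _ _ _]thinmx0 [xs]thinmx0 subrr ltW.
have [p hp] := hF xs.
have muL := oracle_constants_le hp; have {}DE := DE muL.
have gap k : (k < K)%N -> F (ram_point H mu e z0 k.+1) - F xs <=
    mu / 32 * dotv (ram_point H mu e z0 k - xs) (ram_point H mu e z0 k - xs)
    + eps / 50.
  move=> kK; have callk i := hcall k i kK; have subk i := hsub k i kK.
  move: callk subk; rewrite /ram_at ramE => callk subk.
  rewrite {1}/ram_point /= ramE.
  exact: (am_restart_gap (phi := phi) (psi := psi) xs L0 Lp0 LH mu0 muL eps0
    D0 d1D d2D efD DE hF callk subk).
have growth z : mu / 4 * dotv (z - xs) (z - xs) <= F z - F xs + eps / 200.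
  have h1 : (mu + 2 * L) * (delta1 + delta2) <= 6 * (L * D).
    rewrite (_ : 6 * (L * D) = (3 * L) * (2 * D)); last by ring.
    apply: le_trans (_ : (mu + 2 * L) * (2 * D) <= _).
      by rewrite ler_pM2l; lra.
    by rewrite ler_pM2r; lra.
  have h2 : 0 <= H * D by rewrite mulr_ge0 ?ltW //; lra.
  rewrite -(ler_pM2l mu0).
  by have := quadratic_growth z L0 mu0 xs_min hp; have := mulr_gt0 eps0 mu0; lra.
(* The noise [eps / 8] is preserved since [1/64 + 4 (1/50 + 1/200) < 1/8]. *)
have dist k : (k < K)%N ->
    mu * dotv (ram_point H mu e z0 k - xs) (ram_point H mu e z0 k - xs) <=
    mu * R0 ^+ 2 / 8 ^+ k + eps / 8.
  elim: k => [|k IH] kK.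
    rewrite expr0 divr1 -sqr_enorm.
    have : mu * enorm (z0 - xs) ^+ 2 <= mu * R0 ^+ 2; last by lra.
    rewrite ler_pM2l // lerXn2r ?nnegrE ?sqrtr_ge0 //.
    exact: le_trans (sqrtr_ge0 _) z0R.
  have := growth (ram_point H mu e z0 k.+1).
  have := gap k (ltnW kK); have := IH (ltnW kK).
  by rewrite (exprS 8 k) invfM; lra.
case: K K0 hK gap dist {hcall hsub} => // K _ hK gap dist.
have := gap K (ltnSn K); have := dist K (ltnSn K).
(* The last restart is used for its function gap, so the distance is needed only one restart
   earlier. *)
have : mu * R0 ^+ 2 / 8 ^+ K <= 8 * eps; last by lra.
rewrite ler_pdivrMr ?exprn_gt0 //; apply: le_trans hK _.
rewrite (exprS 2 K).
have : eps * 2 ^+ K <= eps * 8 ^+ K; last by lra.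
by rewrite ler_pM2l // lerXn2r ?nnegrE // ler_nat.
Qed.

(** * Number of calls and its soft-O form *)

(** The summand 2 in [log2 (4 X) = 2 + log2 X] absorbs the rounding of [K]; the rounding of the
    restart length, doubled, is the [+ 2] of [call_bound]. *)
Lemma ram_call_bound (R : realType) (H mu R0 eps : R) :
  0 < H -> 0 < mu -> 0 < eps -> 4 * eps < mu * R0 ^+ 2 ->
  (nceil (2 * log2 (mu * R0 ^+ 2 / (4 * eps))) * ram_iters H mu)%N%:R
    <= call_bound H mu R0 eps.
Proof.
move=> H0 mu0 eps0 hK.
set X := mu * R0 ^+ 2 / (4 * eps).
have X1 : 1 < X by rewrite ltr_pdivlMr ?mul1r // mulr_gt0.
have lX := log2_gt0 X1.
rewrite /call_bound (_ : mu * R0 ^+ 2 / eps = 4 * X); last first.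
  by rewrite /X; field; rewrite gt_eqF.
have X0 := lt_trans ltr01 X1.
rewrite log2M // log2_4.
have hceil : (nceil (2 * log2 X))%:R < 2 * log2 X + 1.
  by apply: nceil_lt; rewrite mulr_ge0 // ltW.
have := ram_iters_le H mu.
have -> : Num.sqrt (128 * H / mu) = 8 * Num.sqrt 2 * Num.sqrt (H / mu).
  have -> : 128 * H / mu = 8 ^+ 2 * (2 * (H / mu)) by field; rewrite gt_eqF.
  by rewrite sqrtrM ?exprn_ge0 // sqrtr_sqr ger0_norm // sqrtrM // mulrA.
move=> hN; rewrite natrM mulrC.
apply: le_trans (ler_pM (ler0n _ _) (ler0n _ _) hN (ltW hceil)) _.
have q0 : 0 <= 8 * Num.sqrt 2 * Num.sqrt (H / mu) + 1.
  by rewrite addr_ge0 // !mulr_ge0 // sqrtr_ge0.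
have : (8 * Num.sqrt 2 * Num.sqrt (H / mu) + 1) * (2 * log2 X + 1) <=
  (8 * Num.sqrt 2 * Num.sqrt (H / mu) + 1) * (2 * (2 + log2 X)).
  by rewrite ler_wpM2l //; lra.
by lra.
Qed.

(** For fixed [rho] the logarithm is at most [(1 + |ln rho|) (1 + |ln (1 / eps)|) / ln 2], and the
    other factor is at most a multiple of the maximum. *)
Lemma call_bound_softO (R : realType) (rho : R) :
  is_softO (params_of_scale rho) (@par_eps R) (@par_sigma R)
    (fun i => call_bound (par_H i) (par_mu i) (par_R0 i) (par_eps i))
    (fun i => Num.max (Num.sqrt (par_H i / par_mu i)) 1).
Proof.
have l2 : 0 < ln (2 : R) by rewrite ln_gt0 // ltr1n.
have s2 : 0 <= Num.sqrt (2 : R) by rewrite sqrtr_ge0.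
exists ((16 * Num.sqrt 2 + 2) * ((1 + `|ln rho|) / ln 2)), 1%N, 0%N; split.
  by rewrite mulr_gt0 ?divr_gt0 // ltr_pwDl // ?mulr_ge0.
move=> [H mu R0 eps sigma] [[/= H0 mu0 R00] [/= rhoE eps0 eps_rho _]].
rewrite expr0 mulr1 expr1 /call_bound rhoE.
have rho0 : 0 < rho by lra.
set m := Num.max _ _.
have m1 : 1 <= m by rewrite le_max lexx orbT.
have mq : Num.sqrt (H / mu) <= m by rewrite le_max lexx.
have m0 : 0 <= m by lra.
rewrite normrM (ger0_norm m0) ger0_norm; last first.
  by rewrite addr_ge0 // !mulr_ge0 // sqrtr_ge0.
have hm : 16 * Num.sqrt 2 * Num.sqrt (H / mu) + 2 <= (16 * Num.sqrt 2 + 2) * m.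
  have := ler_wpM2l s2 mq; lra.
have hl : `|log2 (rho / eps)| <=
    (1 + `|ln rho|) / ln 2 * (1 + `|ln eps^-1|).
  rewrite /log2 normrM (gtr0_norm (_ : 0 < (ln 2)^-1)) ?invr_gt0 //.
  rewrite mulrAC ler_pM2r ?invr_gt0 // lnM ?posrE ?invr_gt0 //.
  apply: le_trans (ler_normD _ _) _.
  have := mulr_ge0 (normr_ge0 (ln rho)) (normr_ge0 (ln eps^-1)).
  by lra.
apply: le_trans (ler_pM _ (normr_ge0 _) hm hl) _.
  by rewrite addr_ge0 // !mulr_ge0 // sqrtr_ge0.
by rewrite le_eqVlt; apply/orP; left; apply/eqP; ring.
Qed.

(* Stated for a symbolic constant [c], as the statement's [864 ^+ 2] is a
   unary numeral that conversion may try to evaluate. *)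
Lemma inexactness_gt0 (R : realType) (eps mu L H c : R) :
  0 < eps -> 0 < mu -> 0 < L + H -> 0 < c ->
  0 < eps * mu ^+ 2 / (c * (L + H) ^+ 2).
Proof. by move=> *; rewrite divr_gt0 ?mulr_gt0 ?exprn_gt0. Qed.

(** Multiplying by [c (L + H)] leaves [eps mu] times [mu / (L + H)], a ratio below 1 since
    [mu <= L]. *)
Lemma inexactness_le (R : realType) (eps mu L H b c : R) :
  0 < eps -> 0 < mu -> 0 < H -> mu <= L -> 0 < c -> b <= c ->
  b * ((L + H) * (eps * mu ^+ 2 / (c * (L + H) ^+ 2))) <= eps * mu.
Proof.
move=> eps0 mu0 H0 muL c0 bc.
have LH0 : 0 < L + H by lra.
have e0 : 0 < (L + H) * (eps * mu ^+ 2 / (c * (L + H) ^+ 2)).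
  by rewrite mulr_gt0 // inexactness_gt0.
apply: le_trans (ler_wpM2r (ltW e0) bc) _.
have -> : c * ((L + H) * (eps * mu ^+ 2 / (c * (L + H) ^+ 2))) =
    eps * mu * (mu / (L + H)) by field; rewrite !gt_eqF.
apply: ler_piMr; first by rewrite mulr_ge0 ?ltW.
by rewrite ler_pdivrMr // mul1r; lra.
Qed.

(** * Choice of the noise level and union bound over all iterations *)

Theorem theorem4
  (R : realType) (dp : measure_display) (T : measurableType dp)
  (P : probability T R) (d : nat)
  (phi psi : 'rV[R]_d -> R) (xs z0 : 'rV[R]_d)
  (eps sigma H R0 delta1 delta2 sigma0 L mu Lphi Lpsi epsf sigmat : R)
  (oF : 'rV[R]_d -> T -> R * 'rV[R]_d)
  (env : T -> am_env R d)
  (K := nceil (2 * log2 (mu * R0 ^+ 2 / (4 * eps))))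
  (* the problem *)
  (phi_convex : convex_function setT phi)
  (psi_convex : convex_function setT psi)
  (F_convex : convex_function setT (phi \+ psi))
  (xs_min : is_minimizer (phi \+ psi) xs)
  (eps_gt0 : 0 < eps) (sigma01 : 0 < sigma < 1)
  (mu_gt0 : 0 < mu) (L_gt0 : 0 < L) (Lphi_gt0 : 0 < Lphi) (Lpsi_gt0 : 0 < Lpsi)
  (H_ge : 2 * Lphi <= H)
  (R0_gt0 : 0 < R0) (z0_near : enorm (z0 - xs) <= R0)
  (* K = 2 log2 (mu R0^2 / (4 eps)) is positive *)
  (K_pos : 4 * eps < mu * R0 ^+ 2)
  (* inexact oracles *)
  (delta1_gt0 : 0 < delta1) (delta2_gt0 : 0 < delta2)
  (delta1_le : delta1 <= delta_bound eps mu L Lphi Lpsi H R0)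
  (delta2_le : delta2 <= delta_bound eps mu L Lphi Lpsi H R0)
  (sigma0_le : sigma0 <= sigma / (2 * call_bound H mu R0 eps))
  (oracle_F : forall x : 'rV[R]_d,
     is_oracle P (phi \+ psi) delta1 delta2 sigma0 L mu x (oF x))
  (oracle_phi_psi : forall k i : nat, (k < K)%N -> (i < ram_iters H mu)%N ->
     prob_ge P (1 - sigma0)
       [set w | am_call_ok phi psi delta1 delta2 Lphi Lpsi H (env w)
                  (ram_at H mu (env w) z0 k i)])
  (* inexact solution of the auxiliary problems *)
  (epsf_le : epsf <= eps * mu ^+ 2 / (864 ^+ 2 * (L + H) ^+ 2))
  (sigmat_le : sigmat <= sigma / (2 * call_bound H mu R0 eps))
  (subproblem : forall k i : nat, (k < K)%N -> (i < ram_iters H mu)%N ->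
     prob_ge P (1 - sigmat)
       [set w | am_sub_ok psi H epsf (env w) (ram_at H mu (env w) z0 k i)]) :
  [/\ prob_ge P (1 - sigma)
        [set w | (phi \+ psi) (ram_point H mu (env w) z0 K)
                   - (phi \+ psi) xs <= eps],
      forall w : T,
        (am_calls (ram H mu (env w) z0 K))%:R <= call_bound H mu R0 eps,
      is_softO (params_of_scale (mu * R0 ^+ 2)) (@par_eps R) (@par_sigma R)
        (fun i => call_bound (par_H i) (par_mu i) (par_R0 i) (par_eps i))
        (fun i => Num.max (Num.sqrt (par_H i / par_mu i)) 1)
    & forall w : T,
        am_solves (ram H mu (env w) z0 K) = am_calls (ram H mu (env w) z0 K)].
Proof.
have H_gt0 : 0 < H by apply: lt_le_trans H_ge; rewrite mulr_gt0.
have X_gt1 : 1 < mu * R0 ^+ 2 / (4 * eps).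
  by rewrite ltr_pdivlMr ?mul1r // mulr_gt0.
have K_gt0 : (0 < K)%N.
  rewrite -(ltr_nat R); apply: lt_le_trans (nceil_ge _).
  by rewrite mulr_gt0 // log2_gt0.
have calls_le := ram_call_bound H_gt0 mu_gt0 eps_gt0 K_pos.
rewrite -/K in calls_le.
split; last 3 first.
- by move=> w; rewrite ram_calls.
- exact: call_bound_softO.
- by move=> w; rewrite ram_calls ram_solves.
have [sigma_gt0 sigma_lt1] := andP sigma01.
have cb_ge1 : 1 <= call_bound H mu R0 eps.
  apply: le_trans calls_le.
  by rewrite -[X in X <= _]/(1%:R) ler_nat muln_gt0 K_gt0 ram_iters_gt0.
have cb_gt0 : 0 < call_bound H mu R0 eps by lra.
have sigma_cb : sigma / (2 * call_bound H mu R0 eps) * call_bound H mu R0 eps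
    = sigma / 2 by field; rewrite gt_eqF.
(* The oracle of F enters only through the existence of a valid answer. As [sigma0 < 1], some
   outcome provides one at each point, so F adds nothing to the union bound. *)
have oracle_F_exists x :
    exists o, oracle_ineq (phi \+ psi) delta1 delta2 L mu x o.
  have [|w hw] := prob_ge_nonempty _ (oracle_F x); last by exists (oF x w).
  have : sigma0 * 1 < 1; last by lra.
  have [s0|s0] := leP sigma0 0; first by lra.
  have := ler_pM (ltW s0) ler01 sigma0_le cb_ge1.
  by rewrite sigma_cb; lra.
have c_ge : 720 * 1000 <= 864 ^+ 2 :> R by clear; lra.
have LH_gt0 : 0 < L + H by rewrite addr_gt0.
have c_gt0 : 0 < 864 ^+ 2 :> R by clear; lra.
(* The common level [D] is the third entry of [delta_bound], which is also the bound on [epsf]. *)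
have D_gt0 := inexactness_gt0 eps_gt0 mu_gt0 LH_gt0 c_gt0.
have delta_bound_le : delta_bound eps mu L Lphi Lpsi H R0 <=
    eps * mu ^+ 2 / (864 ^+ 2 * (L + H) ^+ 2).
  by rewrite /delta_bound !ge_min lexx !orbT.
have DE (muL : mu <= L) := inexactness_le eps_gt0 mu_gt0 H_gt0 muL c_gt0 c_ge.
have good k i : (k < K)%N -> (i < ram_iters H mu)%N ->
    prob_ge P (1 - (sigma0 + sigmat))
      ([set w | am_call_ok phi psi delta1 delta2 Lphi Lpsi H (env w)
                  (ram_at H mu (env w) z0 k i)] `&`
       [set w | am_sub_ok psi H epsf (env w) (ram_at H mu (env w) z0 k i)]).
  by move=> kK iN; apply: prob_geI; [apply: oracle_phi_psi | apply: subproblem].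
have := prob_ge_forall (fun k kK => prob_ge_forall (fun i => good k i kK)).
apply: prob_geS => [|w hw].
  rewrite lerD2l lerN2 mulrA -natrM.
  (* Replacing the iteration count by [call_bound] requires a positive failure probability;
     otherwise the total is at most 0. *)
  have [s0|s0] := leP (sigma0 + sigmat) 0.
    by apply: le_trans (ltW sigma_gt0); rewrite mulr_ge0_le0.
  apply: le_trans (ler_wpM2r (ltW s0) calls_le) _.
  have := ler_wpM2l (ltW cb_gt0) (lerD sigma0_le sigmat_le).
  by move: sigma_cb; clear; move: (sigma / _) => q; lra.
apply: (ram_gap (phi := phi) (psi := psi) L_gt0 Lphi_gt0 H_ge mu_gt0 eps_gt0
  D_gt0 _ _ _ DE xs_min z0_near K_gt0 _ oracle_F_exists).
- exact: le_trans delta1_le delta_bound_le.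
- exact: le_trans delta2_le delta_bound_le.
- exact: epsf_le.
(* [K] is at least [2 log2 X], hence at least [log2 X], which gives [X <= 2^K]. *)
- rewrite -ler_pdivrMl ?mulr_gt0 // mulrC; apply: le_pow_log2.
    exact: lt_trans ltr01 X_gt1.
  apply: le_trans (nceil_ge _); apply: ler_peMl; last by rewrite ler1n.
  exact/ltW/log2_gt0.
- by move=> k i kK iN; have [+ _] := hw k kK i iN; exact.
- by move=> k i kK iN; have [_ +] := hw k kK i iN; exact.
Qed.
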